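(* Let $R$ be a commutative semiring, $v:R\to M$ a surjective m-valuation, and $\varphi:R\to U$ a surjective supervaluation covering $v$ (i.e. a surjective m-supervaluation covering $v$ whose target $U$ is a supertropical semiring), with tangible lift $\tilde\varphi:R\to\widetilde U$. Let $\mathfrak q:=v^{-1}(0)$ and $\mathfrak q':=\mathfrak q\cup Y(v)$, and let $\check\varphi$ denote the tangible lift of $\varphi$ outside the ideal $v(\mathfrak q')=\{0\}\cup v(Y(v))$ of $M$, $$\check\varphi:=\tilde\varphi_{v(\mathfrak q')}:R\to\check U:=\widetilde U/E_{v(\mathfrak q')}.$$ (i) $\check\varphi$ is again a supervaluation. More precisely, $\check\varphi$ coincides with the supervaluation $(\tilde\varphi)^\wedge$ associated to the tangible lift $\tilde\varphi:R\to\widetilde U$ of $\varphi$. (ii) If $\psi$ is an m-supervaluation covering $v$ with $\varphi\le\psi\le\tilde\varphi$, then $\psi$ is a supervaluation if and only if $\psi\le\check\varphi$. Thus $$[\varphi,\tilde\varphi]\cap\mathrm{Cov}(v)=[\varphi,\check\varphi].$$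
   Context: A supertropical monoid is a commutative monoid $(U,\cdot)$ with absorbing element $0$ and a distinguished idempotent $e=e_U$ such that $ex=0$ implies $x=0$, together with a total ordering on $eU$ compatible with multiplication and with $0\le a$ for all $a\in eU$. Then $eU$ is a bipotent semiring with unit $e$ and addition $\max$. $\mathcal T(U):=U\setminus eU$, $\mathcal T(U)_0:=\mathcal T(U)\cup\{0\}$. Define an addition on $U$ by $x+y=y$ if $ex<ey$, $x+y=x$ if $ex>ey$, $x+y=ex$ if $ex=ey$. If multiplication distributes over this addition, $U$ is called a supertropical semiring (''$U$ is a semiring''). An m-valuation on $R$ is a map $v:R\to M$ to a bipotent semiring $M$ with $v(0)=0$, $v(1)=1$, $v(ab)=v(a)v(b)$, $v(a+b)\le v(a)+v(b)$. An m-supervaluation is a map $\varphi:R\to U$ to a supertropical monoid with $\varphi(0)=0$, $\varphi(1)=1$, $\varphi(ab)=\varphi(a)\varphi(b)$ such that $e\varphi:R\to eU$ is an m-valuation; it is a supervaluation if $U$ is a supertropical semiring. It covers $v:R\to M$ if $eU=M$ and $e\varphi=v$. It is surjective if $U=\varphi(R)\cup e\varphi(R)$. For m-supervaluations $\varphi:R\to U$, $\psi:R\to V$: $\varphi\ge\psi$ if for all $a,b\in R$: $\varphi(a)=\varphi(b)\Rightarrow\psi(a)=\psi(b)$; $e\varphi(a)\le e\varphi(b)\Rightarrow e\psi(a)\le e\psi(b)$; $\varphi(a)\in eU\Rightarrow\psi(a)\in eV$. $\varphi\sim\psi$ (equivalence) means $\varphi\ge\psi$ and $\psi\ge\varphi$.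 $\mathrm{Cov}_m(v)$ is the poset of equivalence classes $[\psi]$ of m-supervaluations covering $v$, and $\mathrm{Cov}(v)$ its subset of classes of supervaluations covering $v$. For $\varphi\le\rho$, $[\varphi,\rho]$ denotes the interval of all $[\psi]\in\mathrm{Cov}_m(v)$ with $\varphi\le\psi\le\rho$. $Y(v)$ is the set of all products $ab$ with $a,b\in R$ for which there exists $a'\in R$ with $v(a')<v(a)$ and $v(a'b)=v(ab)\ne0$. Ghost value set: $G(\psi):=\psi(R)\cap M$ for $\psi$ covering $v$. (For a supervaluation $\varphi$ as in the claim, $v(\mathfrak q')\subset G(\varphi)$.) Tangible lift of $\varphi$: let $N:=\varphi(R)$ and $s:N\to\widetilde N$, $x\mapsto s(x)=\tilde x$, a monoid isomorphism onto a copy of $N$. Let $\widetilde U=\widetilde N\cup M$ be the disjoint union of $\widetilde N$ and $M=eU$ with the zeros identified, with the given products within $\widetilde N$ and within $M$, and $\tilde x\cdot y=(ex)y$ for $x\in N$, $y\in M$; unit $\tilde1$, distinguished idempotent $e\in M$, given ordering on $M=e\widetilde U$. This is a supertropical monoid with $\mathcal T(\widetilde U)_0=\widetilde N$, and $\tilde\varphi(a):=\widetilde{\varphi(a)}$. Tangible lift outside $\mathfrak a$: for an ideal $\mathfrak a$ of $M$ with $\mathfrak a\subset G(\varphi)$, let $E_{\mathfrak a}$ be the equivalence relation on $\widetilde U$ with $x\sim y$ iff $x=y$, or $x,y\in s(\mathfrak a)\cup M$ and $ex=ey$; $\tilde\varphi_{\mathfrak a}:R\to\widetilde U/E_{\mathfrak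 a}$ is $\tilde\varphi$ followed by the quotient map. The ghost ideal of $\widetilde U/E_{\mathfrak a}$ is identified with $M$. Associated supervaluation: in a supertropical monoid $V$, an NC-product is an element $x=yz$ ($y,z\in V$) for which there is $y'\in eV$ with $y'<ey$ and $y'z=eyz\ne0$. $S(V)$ is the set of tangible NC-products of $V$. $\widehat V:=V/E(V,S(V))$, where $x\sim y$ in $E(V,S(V))$ iff $x=y$, or $x,y\in eV\cup V\cdot S(V)$ and $ex=ey$. $\widehat V$ is a supertropical semiring, and for an m-supervaluation $\psi:R\to V$, $\psi^\wedge:R\to\widehat V$ is $\psi$ followed by the quotient map $V\to\widehat V$.
   Formalization: In (ii), ''ψ ≤ φ̌ implies ψ is a supervaluation'' is stated only for surjective ψ, since it fails when the target of ψ has elements outside ψ(R) ∪ eψ(R); the other direction and the equality of intervals are stated in full. *)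

(* Defs.v *)
From HB Require Import structures.
From mathcomp Require Import all_boot all_order all_algebra.
From mathcomp Require Import boolp classical_sets.

Set Implicit Arguments.
Unset Strict Implicit.
Unset Printing Implicit Defensive.

Import GRing.Theory.
Local Open Scope ring_scope.
Local Open Scope classical_set_scope.
Local Open Scope quotient_scope.

(** * Bipotent semirings and m-valuations *)

HB.mixin Record isBipotent M of GRing.ComPzSemiRing M := {
  bipotent : forall a b : M, a + b = a \/ a + b = b
}.

#[short(type="bipotentSemiRingType")]
HB.structure Definition BipotentSemiRing :=
  { M of GRing.ComPzSemiRing M & isBipotent M }.

(* The total order of a bipotent semiring, for which [a + b = max a b]. *)
Definition bple (M : bipotentSemiRingType) : rel M := fun a b => a + b == b.
Definition bplt (M : bipotentSemiRingType) : rel M :=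
  fun a b => bple a b && (a != b).

Record is_mvaluation (R : comPzSemiRingType) (M : bipotentSemiRingType)
    (v : R -> M) : Prop := IsMValuation {
  mval0 : v 0 = 0;
  mval1 : v 1 = 1;
  mvalM : forall a b, v (a * b) = v a * v b;
  mvalD : forall a b, bple (v (a + b)) (v a + v b)
}.

(** * Supertropical monoids *)

(* [stle] is only meaningful on the ghost ideal [eU]; this is why every
   argument of [stle] below is of the form [e * x]. *)
HB.mixin Record isSupertropicalMonoid U of Monoid U := {
  stzero : U;
  ste : U;
  stle : rel U;
  stmulC : forall x y : U, (x * y = y * x)%g;
  stmul0 : forall x : U, (stzero * x = stzero)%g;
  ste_idem : (ste * ste = ste)%g;
  ste_eq0 : forall x : U, (ste * x = stzero)%g -> x = stzero;
  stle_total : forall x y : U,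
    stle (ste * x)%g (ste * y)%g || stle (ste * y)%g (ste * x)%g;
  stle_anti : forall x y : U,
    stle (ste * x)%g (ste * y)%g -> stle (ste * y)%g (ste * x)%g ->
    (ste * x = ste * y)%g;
  stle_trans : forall y x z : U,
    stle (ste * x)%g (ste * y)%g -> stle (ste * y)%g (ste * z)%g ->
    stle (ste * x)%g (ste * z)%g;
  stle_mul : forall x y z : U,
    stle (ste * x)%g (ste * y)%g ->
    stle ((ste * x) * (ste * z))%g ((ste * y) * (ste * z))%g;
  stle0 : forall x : U, stle stzero (ste * x)%g
}.

#[short(type="stMonoidType")]
HB.structure Definition SupertropicalMonoid :=
  { U of Monoid U & isSupertropicalMonoid U }.

Section SupertropicalMonoidTheory.
Context {U : stMonoidType}.
Implicit Types x y z : U.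

Definition stlt : rel U := fun x y => stle x y && (x != y).

Definition stadd x y : U :=
  if stlt (ste * x)%g (ste * y)%g then y
  else if stlt (ste * y)%g (ste * x)%g then x
  else (ste * x)%g.

Definition is_ghost : pred U := fun x => (ste * x)%g == x.

Lemma ghostP x : reflect (exists y, x = (ste * y)%g) (is_ghost x).
Proof.
apply: (iffP eqP) => [<-|[y ->]]; first by exists x.
by rewrite mulgA ste_idem.
Qed.

Lemma stmul_r0 x : (x * stzero = stzero :> U)%g.
Proof. by rewrite stmulC stmul0. Qed.

Lemma steM x y : (ste * (x * y) = (ste * x) * (ste * y))%g.
Proof.
by rewrite [RHS]mulgA (stmulC (ste * x)%g ste) !mulgA ste_idem.
Qed.

Lemma eeE x : (ste * (ste * x) = ste * x)%g.
Proof. by rewrite mulgA ste_idem. Qed.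

Lemma stle_refl x : stle (ste * x)%g (ste * x)%g.
Proof. by have := stle_total x x; rewrite orbb. Qed.

Lemma ghost_e x : is_ghost x -> (ste * x)%g = x.
Proof. by move/eqP. Qed.

Lemma is_ghost_ste x : is_ghost (ste * x)%g.
Proof. by apply/ghostP; exists x. Qed.

Lemma is_ghostM x y : is_ghost y -> is_ghost (x * y)%g.
Proof.
by move=> /eqP yg; rewrite /is_ghost (stmulC x) mulgA yg.
Qed.

End SupertropicalMonoidTheory.

(* [U] is a supertropical semiring. *)
Definition is_stsemiring (U : stMonoidType) : Prop :=
  forall x y z : U, (x * stadd y z)%g = stadd (x * y)%g (x * z)%g.

(** ** The ghost ideal [eU] as a bipotent semiring with unit [e] *)

Definition ghost (U : stMonoidType) : Type := {x : U | is_ghost x}.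

HB.instance Definition _ (U : stMonoidType) := Choice.on (ghost U).

Section GhostSemiring.
Variable U : stMonoidType.
Implicit Types a b c : ghost U.

Definition to_ghost (x : U) : ghost U := exist _ (ste * x)%g (is_ghost_ste x).

Definition gzero : ghost U := to_ghost stzero.
Definition gone : ghost U := to_ghost 1%g.
Definition gmul a b : ghost U := to_ghost (val a * val b)%g.
Definition gadd a b : ghost U := if stle (val a) (val b) then b else a.

Lemma valgE a : (ste * val a)%g = val a.
Proof. by case: a => x /= /eqP. Qed.

Lemma to_ghost_val a : to_ghost (val a) = a.
Proof. by apply: val_inj; rewrite /= valgE. Qed.

Lemma val_gzero : val gzero = stzero.
Proof. by rewrite /= stmul_r0. Qed.

Lemma val_gmul a b : val (gmul a b) = (val a * val b)%g.
Proof. by rewrite /= steM !valgE. Qed.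

Lemma gle_total a b : stle (val a) (val b) || stle (val b) (val a).
Proof. by rewrite -(valgE a) -(valgE b) stle_total. Qed.

Lemma gle_anti a b : stle (val a) (val b) -> stle (val b) (val a) -> a = b.
Proof.
move=> ab ba; apply: val_inj; rewrite -(valgE a) -(valgE b).
by apply: stle_anti; rewrite !valgE.
Qed.

Lemma gle_trans b a c :
  stle (val a) (val b) -> stle (val b) (val c) -> stle (val a) (val c).
Proof.
rewrite -(valgE a) -(valgE b) -(valgE c); exact: stle_trans.
Qed.

Lemma gle_mul a b c :
  stle (val a) (val b) -> stle (val (gmul a c)) (val (gmul b c)).
Proof.
move=> ab; rewrite !val_gmul -(valgE a) -(valgE b) -(valgE c).
by apply: stle_mul; rewrite !valgE.
Qed.

Lemma gaddC : commutative gadd.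
Proof.
move=> a b; rewrite /gadd; have := gle_total a b.
case: ifP => ab; case: ifP => ba //= _.
exact: gle_anti.
Qed.

Lemma gaddA : associative gadd.
Proof.
move=> a b c; rewrite /gadd.
case bc: (stle (val b) (val c)); case ab: (stle (val a) (val b)) => //=.
- by rewrite bc (gle_trans ab bc).
- by rewrite bc.
- have := gle_total a b; have := gle_total b c; rewrite ab bc /= => cb ba.
  case: ifP => // ac; move: bc.
  by rewrite (gle_trans ba ac).
Qed.

Lemma gadd0 : left_id gzero gadd.
Proof. by move=> a; rewrite /gadd val_gzero -(valgE a) stle0. Qed.

Lemma gmulA : associative gmul.
Proof. by move=> a b c; apply: val_inj; rewrite !val_gmul mulgA. Qed.

Lemma gmulC : commutative gmul.
Proof. by move=> a b; apply: val_inj; rewrite !val_gmul stmulC. Qed.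

Lemma gmul1 : left_id gone gmul.
Proof. by move=> a; apply: val_inj; rewrite val_gmul /= mulg1 valgE. Qed.

Lemma gmulDl : left_distributive gmul gadd.
Proof.
move=> a b c; rewrite /gadd; case: ifP => ab.
  by rewrite gle_mul.
have := gle_total a b; rewrite ab /= => /(@gle_mul _ _ c) ba.
by case: ifP => // ab'; apply: gle_anti.
Qed.

Lemma gmul0 : left_zero gzero gmul.
Proof. by move=> a; apply: val_inj; rewrite val_gmul !val_gzero stmul0. Qed.

HB.instance Definition _ := GRing.isNmodule.Build (ghost U) gaddA gaddC gadd0.
HB.instance Definition _ := GRing.Nmodule_isComPzSemiRing.Build (ghost U)
  gmulA gmulC gmul1 gmulDl gmul0.

Lemma gbipotent a b : a + b = a \/ a + b = b.
Proof.
by rewrite /GRing.add /= /gadd; case: ifP => _; [right | left].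
Qed.

HB.instance Definition _ := isBipotent.Build (ghost U) gbipotent.

Lemma bple_ghostE a b : bple a b = stle (val a) (val b).
Proof.
rewrite /bple {1}/GRing.add /= /gadd.
case: ifP => [|ab]; first by rewrite eqxx.
apply/eqP => eab; move: ab; rewrite eab -(valgE b).
by rewrite stle_refl.
Qed.

Lemma to_ghostM (x y : U) : to_ghost (x * y)%g = to_ghost x * to_ghost y.
Proof. by apply: val_inj; rewrite val_gmul /= steM. Qed.

Lemma to_ghost1 : to_ghost 1%g = 1. Proof. by []. Qed.
Lemma to_ghost0 : to_ghost stzero = 0. Proof. by []. Qed.

Lemma to_ghost_eq0 (x : U) : to_ghost x = 0 -> x = stzero.
Proof.
move=> /(congr1 val); rewrite /GRing.zero val_gzero /=.
exact: ste_eq0.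
Qed.

End GhostSemiring.

(** * m-supervaluations *)

Record is_msupervaluation (R : comPzSemiRingType) (U : stMonoidType)
    (phi : R -> U) : Prop := IsMSupervaluation {
  msv0 : phi 0 = stzero;
  msv1 : phi 1 = 1%g;
  msvM : forall a b, phi (a * b) = (phi a * phi b)%g;
  msv_ghost : is_mvaluation (fun a => to_ghost (phi a))
}.

Record msupervaluation (R : comPzSemiRingType) := MSupervaluation {
  msv_target : stMonoidType;
  msv_fun :> R -> msv_target;
  msvP : is_msupervaluation msv_fun
}.

Definition is_supervaluation (R : comPzSemiRingType)
    (phi : msupervaluation R) : Prop :=
  is_stsemiring (msv_target phi).

Definition is_surjective_msv (R : comPzSemiRingType)
    (phi : msupervaluation R) : Prop :=
  forall x : msv_target phi,
    (exists a, x = phi a) \/ (exists a, x = (ste * phi a)%g).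

(* [msv_le psi phi] is [phi >= psi]. *)
Record msv_le (R : comPzSemiRingType) (psi phi : msupervaluation R) : Prop :=
  MSVLe {
  msv_le_fun : forall a b, phi a = phi b -> psi a = psi b;
  msv_le_order : forall a b,
    stle (ste * phi a)%g (ste * phi b)%g ->
    stle (ste * psi a)%g (ste * psi b)%g;
  msv_le_ghost : forall a, is_ghost (phi a) -> is_ghost (psi a)
}.

Definition msv_equiv (R : comPzSemiRingType) (phi psi : msupervaluation R) :=
  msv_le phi psi /\ msv_le psi phi.

(* An m-supervaluation [phi : R -> U] covering [v : R -> M]. The equality
   [eU = M] is rendered by an isomorphism [cov_iso] of semirings from [M] onto
   [eU]; since the order of a bipotent semiring is determined by its addition,
   it is an order isomorphism as well. *)
Record mcover (R : comPzSemiRingType) (M : bipotentSemiRingType) (v : R -> M) :=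
  MCover {
  cov_msv :> msupervaluation R;
  cov_iso : {rmorphism M -> ghost (msv_target cov_msv)};
  cov_iso_bij : bijective cov_iso;
  covE : forall a, to_ghost (cov_msv a) = cov_iso (v a)
}.

(** ** [Cov(v)] and intervals, as collections of equivalence classes *)

Section Cov.
Variables (R : comPzSemiRingType) (M : bipotentSemiRingType) (v : R -> M).

(* Not [set (mcover v)]: [mcover v] lives in a universe above that of the
   carriers of supertropical monoids, which [set] does not allow. *)
Definition covering_class := mcover v -> Prop.

Definition class_of (psi : mcover v) : covering_class :=
  fun rho => msv_equiv psi rho.

Definition Cov (C : covering_class) : Prop :=
  exists psi : mcover v, is_supervaluation psi /\ C = class_of psi.

(* The interval [[phi, rho]] of [Cov_m(v)]. *)
Definition cov_interval (phi rho : mcover v) (C : covering_class) : Prop :=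
  exists psi : mcover v, [/\ msv_le phi psi, msv_le psi rho & C = class_of psi].

(* The ghost value set [psi(R) `&` M]. *)
Definition ghost_values (psi : mcover v) : set M :=
  [set m | exists a, psi a = val (cov_iso psi m)].

(* The set [Y(v)]. *)
Definition Yset : set R :=
  [set p | exists a b, p = a * b /\
     exists a', [/\ bplt (v a') (v a), v (a' * b) = v (a * b) & v (a * b) <> 0]].

End Cov.

(** * Quotients by multiplicative fibre-conserving equivalence relations *)

Record mfce (V : stMonoidType) := MFCE {
  mfce_rel :> equiv_rel V;
  mfce_mul : forall x y z : V, mfce_rel x y -> mfce_rel (x * z)%g (y * z)%g;
  mfce_fiber : forall x y : V, mfce_rel x y -> (ste * x = ste * y)%g
}.

Definition stquot (V : stMonoidType) (E : mfce V) : Type :=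
  {eq_quot (mfce_rel E)}.

HB.instance Definition _ (V : stMonoidType) (E : mfce V) :=
  EqQuotient.on (stquot E).
HB.instance Definition _ (V : stMonoidType) (E : mfce V) :=
  Choice.on (stquot E).

Section StQuotient.
Variables (V : stMonoidType) (E : mfce V).
Notation Q := (stquot E).
Implicit Types X Y Z : Q.

Definition stpi (x : V) : Q := \pi_Q x.
Definition qmul X Y : Q := stpi (repr X * repr Y)%g.
Definition qle X Y : bool := stle (ste * repr X)%g (ste * repr Y)%g.

Lemma stpi_eq x y : stpi x = stpi y <-> E x y.
Proof. by split=> [/eqmodP|] //; move=> Exy; apply/eqmodP. Qed.

Lemma stpiP X : exists x, X = stpi x.
Proof. by exists (repr X); rewrite /stpi reprK. Qed.

Lemma repr_stpi x : E (repr (stpi x)) x.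
Proof. by apply/stpi_eq; rewrite /stpi reprK. Qed.

Lemma e_repr x : (ste * repr (stpi x) = ste * x)%g.
Proof. exact: (mfce_fiber (repr_stpi x)). Qed.

Lemma stpiM x y : qmul (stpi x) (stpi y) = stpi (x * y)%g.
Proof.
apply/stpi_eq; apply: (@equiv_trans _ E (x * repr (stpi y))%g).
  exact: mfce_mul (repr_stpi x).
by rewrite (stmulC x) (stmulC x); apply: mfce_mul (repr_stpi y).
Qed.

Lemma qmulA : associative qmul.
Proof.
move=> X Y Z; have [x ->] := stpiP X; have [y ->] := stpiP Y; have [z ->] := stpiP Z.
by rewrite !stpiM mulgA.
Qed.

Lemma qmul1 : left_id (stpi 1%g) qmul.
Proof. by move=> X; have [x ->] := stpiP X; rewrite stpiM mul1g. Qed.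

Lemma qmulr1 : right_id (stpi 1%g) qmul.
Proof. by move=> X; have [x ->] := stpiP X; rewrite stpiM mulg1. Qed.

HB.instance Definition _ := isMonoid.Build Q qmulA qmul1 qmulr1.

Lemma qmulE x y : (stpi x * stpi y)%g = stpi (x * y)%g.
Proof. exact: stpiM. Qed.

Lemma qleE x y : qle (stpi x) (stpi y) = stle (ste * x)%g (ste * y)%g.
Proof. by rewrite /qle !e_repr. Qed.

Lemma qmulC X Y : (X * Y = Y * X)%g.
Proof.
have [x ->] := stpiP X; have [y ->] := stpiP Y.
by rewrite !qmulE stmulC.
Qed.

Lemma qmul0 X : (stpi stzero * X = stpi stzero)%g.
Proof. by have [x ->] := stpiP X; rewrite qmulE stmul0. Qed.

Lemma qe_idem : (stpi ste * stpi ste = stpi ste)%g.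
Proof. by rewrite qmulE ste_idem. Qed.

Lemma qe_eq0 X : (stpi ste * X = stpi stzero)%g -> X = stpi stzero.
Proof.
have [x ->] := stpiP X; rewrite qmulE => /stpi_eq /(@mfce_fiber _ E).
by rewrite eeE stmul_r0 => /ste_eq0 ->.
Qed.

Lemma qle_total X Y :
  qle (stpi ste * X)%g (stpi ste * Y)%g || qle (stpi ste * Y)%g (stpi ste * X)%g.
Proof.
have [x ->] := stpiP X; have [y ->] := stpiP Y.
by rewrite !qmulE !qleE !eeE stle_total.
Qed.

Lemma qle_anti X Y :
  qle (stpi ste * X)%g (stpi ste * Y)%g ->
  qle (stpi ste * Y)%g (stpi ste * X)%g -> (stpi ste * X = stpi ste * Y)%g.
Proof.
have [x ->] := stpiP X; have [y ->] := stpiP Y.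
by rewrite !qmulE !qleE !eeE => xy yx; rewrite (stle_anti _ _ xy yx).
Qed.

Lemma qle_trans Y X Z :
  qle (stpi ste * X)%g (stpi ste * Y)%g ->
  qle (stpi ste * Y)%g (stpi ste * Z)%g -> qle (stpi ste * X)%g (stpi ste * Z)%g.
Proof.
have [x ->] := stpiP X; have [y ->] := stpiP Y; have [z ->] := stpiP Z.
by rewrite !qmulE !qleE !eeE; apply: stle_trans.
Qed.

Lemma qle_mul X Y Z :
  qle (stpi ste * X)%g (stpi ste * Y)%g ->
  qle (stpi ste * X * (stpi ste * Z))%g (stpi ste * Y * (stpi ste * Z))%g.
Proof.
have [x ->] := stpiP X; have [y ->] := stpiP Y; have [z ->] := stpiP Z.
rewrite !qmulE !qleE !eeE => /(@stle_mul _ _ _ z).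
by rewrite -(steM x z) -(steM y z) !eeE.
Qed.

Lemma qle0 X : qle (stpi stzero) (stpi ste * X)%g.
Proof.
by have [x ->] := stpiP X; rewrite qmulE qleE eeE stmul_r0 stle0.
Qed.

HB.instance Definition _ := isSupertropicalMonoid.Build Q
  qmulC qmul0 qe_idem qe_eq0 qle_total qle_anti qle_trans qle_mul qle0.

End StQuotient.

(** The quotient map identifies the ghost ideals of [V] and [V/E]. *)

Section QuotientGhost.
Variables (V : stMonoidType) (E : mfce V).

Definition gpi (a : ghost V) : ghost (stquot E) := to_ghost (stpi E (val a)).

Lemma val_gpi a : val (gpi a) = stpi E (val a).
Proof. by rewrite /= qmulE valgE. Qed.

Lemma gpi_to_ghost x : gpi (to_ghost x) = to_ghost (stpi E x).
Proof. by apply: val_inj; rewrite val_gpi /= qmulE. Qed.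

Lemma gpi_nmod : nmod_morphism gpi.
Proof.
split; first by apply: val_inj; rewrite val_gpi !val_gzero.
move=> a b; rewrite /GRing.add /= /gadd !val_gpi /=.
rewrite {2}/stle /= qleE !valgE.
by case: ifP.
Qed.

Lemma gpi_monoid : monoid_morphism gpi.
Proof.
split; first exact: gpi_to_ghost.
by move=> a b; apply: val_inj; rewrite val_gmul !val_gpi val_gmul qmulE.
Qed.

HB.instance Definition _ :=
  GRing.isNmodMorphism.Build (ghost V) (ghost (stquot E)) gpi gpi_nmod.
HB.instance Definition _ :=
  GRing.isMonoidMorphism.Build (ghost V) (ghost (stquot E)) gpi gpi_monoid.

Lemma gpi_bij : bijective gpi.
Proof.
exists (fun X : ghost (stquot E) => to_ghost (repr (val X))) => [a|X].
  apply: val_inj; rewrite val_gpi /=.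
  by rewrite e_repr valgE.
apply: val_inj; rewrite val_gpi /= -[RHS]valgE.
have [x Xx] := stpiP (val X).
by rewrite Xx e_repr -qmulE -Xx.
Qed.

End QuotientGhost.

Section QuotientMSV.
Variables (R : comPzSemiRingType).

Lemma quot_msvP (psi : msupervaluation R) (E : mfce (msv_target psi)) :
  is_msupervaluation (fun a => stpi E (psi a)).
Proof.
have [p0 p1 pM [g0 g1 gM gD]] := msvP psi.
split=> [|||]; first by rewrite p0.
- by rewrite p1.
- by move=> a b; rewrite pM qmulE.
split=> [||a b|a b]; rewrite -!gpi_to_ghost.
- by rewrite g0 raddf0.
- by rewrite g1 rmorph1.
- by rewrite gM rmorphM.
- by rewrite /bple -!raddfD /=; rewrite (eqP (gD a b)).
Qed.

Definition quot_msv (psi : msupervaluation R) (E : mfce (msv_target psi)) :=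
  MSupervaluation (quot_msvP E).

Variables (M : bipotentSemiRingType) (v : R -> M).

Section QuotientCover.
Variables (psi : mcover v) (E : mfce (msv_target psi)).

Definition quot_iso : {rmorphism M -> ghost (msv_target (quot_msv E))} :=
  (@gpi _ E \o cov_iso psi : {rmorphism _ -> _}).

Lemma quot_iso_bij : bijective quot_iso.
Proof. exact: bij_comp (gpi_bij E) (cov_iso_bij psi). Qed.

Lemma quot_covE a : to_ghost (quot_msv E a) = quot_iso (v a).
Proof. by rewrite /= -gpi_to_ghost covE. Qed.

(* [psi] followed by the quotient map, the ghost ideal of the quotient being
   identified with [M]. *)
Definition quot_cover : mcover v := MCover quot_iso_bij quot_covE.

End QuotientCover.
End QuotientMSV.

(** ** Collapsing an ideal that contains the ghosts *)

Section Collapse.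
Variables (V : stMonoidType) (A : set V).
Hypothesis Amul : forall x z, A x -> A (x * z)%g.

(* [x ~ y] iff [x = y], or [x, y] lie in [A] and [ex = ey]. *)
Definition collapse_rel : rel V := fun x y =>
  (x == y) || [&& `[< A x >], `[< A y >] & (ste * x == ste * y)%g].

Lemma collapse_relP x y :
  reflect (x = y \/ [/\ A x, A y & (ste * x = ste * y)%g]) (collapse_rel x y).
Proof.
apply: (iffP orP) => [[/eqP ->|/and3P[/asboolP ? /asboolP ? /eqP ?]]|].
- by left.
- by right.
- case=> [->|[Ax Ay exy]]; first by left.
  by right; apply/and3P; split; [exact/asboolP | exact/asboolP | exact/eqP].
Qed.

Lemma collapse_refl : reflexive collapse_rel.
Proof. by move=> x; apply/collapse_relP; left. Qed.

Lemma collapse_sym : symmetric collapse_rel.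
Proof.
move=> x y; apply/collapse_relP/collapse_relP => -[->|[? ? ?]]; by [left|right].
Qed.

Lemma collapse_trans : transitive collapse_rel.
Proof.
move=> y x z /collapse_relP[->//|[Ax Ay exy]] /collapse_relP[<-|[_ Az eyz]].
  by apply/collapse_relP; right.
by apply/collapse_relP; right; rewrite exy.
Qed.

Definition collapse_equiv : equiv_rel V :=
  EquivRel collapse_rel collapse_refl collapse_sym collapse_trans.

Lemma collapse_mul x y z :
  collapse_equiv x y -> collapse_equiv (x * z)%g (y * z)%g.
Proof.
move=> /collapse_relP[->|[Ax Ay exy]]; apply/collapse_relP; [by left|right].
by split; [exact: Amul | exact: Amul | rewrite !mulgA exy].
Qed.

Lemma collapse_fiber x y : collapse_equiv x y -> (ste * x = ste * y)%g.
Proof. by move=> /collapse_relP[->|[]]. Qed.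

Definition collapse : mfce V := MFCE collapse_mul collapse_fiber.

End Collapse.

(** * The associated supervaluation *)

Section Associated.
Variable V : stMonoidType.

Definition is_NC_product (x : V) : Prop := exists y z, x = (y * z)%g /\
  exists y', [/\ is_ghost y', stlt y' (ste * y)%g,
    (y' * z = ste * y * z)%g & (ste * y * z)%g <> stzero].

(* [S(V)] *)
Definition NC_tangible : set V := [set x | ~~ is_ghost x /\ is_NC_product x].

(* [eV `|` V * S(V)] *)
Definition NC_ideal : set V :=
  [set x | is_ghost x \/ exists z s, NC_tangible s /\ x = (z * s)%g].

Lemma NC_idealM x z : NC_ideal x -> NC_ideal (x * z)%g.
Proof.
case=> [gx|[y [s [Ss ->]]]]; [left | right].
  by rewrite stmulC is_ghostM.
by exists (z * y)%g, s; split; rewrite // stmulC mulgA.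
Qed.

(* [E(V, S(V))] *)
Definition NC_mfce : mfce V := collapse NC_idealM.

End Associated.

Definition hat_cover (R : comPzSemiRingType) (M : bipotentSemiRingType)
    (v : R -> M) (psi : mcover v) : mcover v :=
  quot_cover (NC_mfce (msv_target psi)).

(** * The tangible lift *)

Section TangibleLift.
Variables (R : comPzSemiRingType) (phi : msupervaluation R).
Notation U := (msv_target phi).

(* The monoid [N = phi(R)]. *)
Definition in_img : pred U := fun x => `[< exists a, x = phi a >].
Definition img : Type := {x : U | in_img x}.
HB.instance Definition _ := Choice.on img.

Lemma in_imgP a : in_img (phi a).
Proof. by apply/asboolP; exists a. Qed.

Definition to_img (a : R) : img := exist _ (phi a) (in_imgP a).

Lemma in_imgM (x y : img) : in_img (val x * val y)%g.
Proof.
case: x y => [x /= /asboolP[a ->]] [y /= /asboolP[b ->]].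
by apply/asboolP; exists (a * b); rewrite (msvM (msvP phi)).
Qed.

Definition img_mul (x y : img) : img := exist in_img _ (in_imgM x y).

(* The disjoint union of a copy of [N] and [eU] with the zeros identified: the
   first summand consists of the nonzero elements of [N], and the common zero
   is that of [eU]. *)
Definition tlift : Type := ({x : img | val x != stzero} + ghost U)%type.
HB.instance Definition _ := Choice.on tlift.

(* The isomorphism [s] from [N] onto its copy. *)
Definition tilde (x : img) : tlift :=
  if @idP (val x != stzero) is ReflectT nz
  then inl (exist _ x nz) else inr 0.

Definition tlift_mul (x y : tlift) : tlift :=
  match x, y with
  | inl x, inl y => tilde (img_mul (val x) (val y))
  | inl x, inr m => inr (to_ghost (val (val x)) * m)
  | inr m, inl y => inr (m * to_ghost (val (val y)))
  | inr m, inr m' => inr (m * m')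
  end.

Definition tlift_ghost (x : tlift) : ghost U :=
  match x with inl x => to_ghost (val (val x)) | inr m => m end.

Definition tlift_le (x y : tlift) : bool :=
  bple (tlift_ghost x) (tlift_ghost y).

Lemma tilde_spec (x : img) :
  (val x = stzero /\ tilde x = inr 0) \/
  (exists nz : val x != stzero, tilde x = inl (exist _ x nz)).
Proof.
rewrite /tilde; case: {-}_ / idP => [nz|/negP]; first by right; exists nz.
by rewrite negbK => /eqP; left.
Qed.

Lemma tilde_inl x : inl x = tilde (val x).
Proof.
case: (tilde_spec (val x)) => [[x0]|[nz ->]].
  by have := valP x; rewrite x0 eqxx.
by congr inl; apply: val_inj.
Qed.

Lemma tilde0 (x : img) : val x = stzero -> tilde x = inr 0.
Proof. by case: (tilde_spec x) => [[]|[nz _ x0]] //; rewrite x0 eqxx in nz. Qed.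

Lemma tlift_ghost_tilde x : tlift_ghost (tilde x) = to_ghost (val x).
Proof. by case: (tilde_spec x) => [[-> ->]|[nz ->]]. Qed.

Lemma tildeM x y : tlift_mul (tilde x) (tilde y) = tilde (img_mul x y).
Proof.
case: (tilde_spec x) => [[x0 ->]|[xnz ->]];
  case: (tilde_spec y) => [[y0 ->]|[ynz ->]] //=;
  rewrite ?tilde0 /= ?x0 ?y0 ?stmul0 ?stmul_r0 //.
- by rewrite mul0r.
- by rewrite mul0r.
- by rewrite mulr0.
Qed.

Lemma tilde_ghostM x m : tlift_mul (tilde x) (inr m) = inr (to_ghost (val x) * m).
Proof. by case: (tilde_spec x) => [[-> ->]|[xnz ->]]. Qed.

Lemma ghost_tildeM x m : tlift_mul (inr m) (tilde x) = inr (m * to_ghost (val x)).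
Proof. by case: (tilde_spec x) => [[-> ->]|[xnz ->]]. Qed.

Lemma ghost_ghostM m m' : tlift_mul (inr m) (inr m') = inr (m * m').
Proof. by []. Qed.

Definition tliftE := (tildeM, tilde_ghostM, ghost_tildeM, ghost_ghostM).

Lemma tliftP (x : tlift) : (exists n, x = tilde n) \/ (exists m, x = inr m).
Proof.
case: x => [x|m]; last by right; exists m.
by left; exists (val x); rewrite tilde_inl.
Qed.

Lemma tlift_ghostM x y :
  tlift_ghost (tlift_mul x y) = tlift_ghost x * tlift_ghost y.
Proof.
have [[n ->]|[m ->]] := tliftP x; have [[k ->]|[l ->]] := tliftP y;
  by rewrite ?tliftE ?tlift_ghost_tilde //= to_ghostM.
Qed.

Lemma tlift_mulA : associative tlift_mul.
Proof.
move=> x y z.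
have [[n ->]|[m ->]] := tliftP x; have [[k ->]|[l ->]] := tliftP y;
  have [[p ->]|[q ->]] := tliftP z; rewrite !tliftE ?to_ghostM ?mulrA //.
by congr tilde; apply: val_inj; rewrite /= mulgA.
Qed.

Lemma tlift_mulC : commutative tlift_mul.
Proof.
move=> x y; have [[n ->]|[m ->]] := tliftP x; have [[k ->]|[l ->]] := tliftP y;
  rewrite !tliftE; last 3 first.
- by rewrite mulrC.
- by rewrite mulrC.
- by rewrite mulrC.
by congr tilde; apply: val_inj; rewrite /= stmulC.
Qed.

Lemma tlift_mul1 : left_id (tilde (to_img 1)) tlift_mul.
Proof.
have v1 : val (to_img 1) = 1%g by rewrite /= (msv1 (msvP phi)).
move=> x; have [[n ->]|[m ->]] := tliftP x; rewrite tliftE.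
  by congr tilde; apply: val_inj; rewrite /= [X in (X * _)%g]v1 mul1g.
by rewrite v1 to_ghost1 mul1r.
Qed.

Lemma tlift_mulr1 : right_id (tilde (to_img 1)) tlift_mul.
Proof. by move=> x; rewrite tlift_mulC tlift_mul1. Qed.

HB.instance Definition _ :=
  isMonoid.Build tlift tlift_mulA tlift_mul1 tlift_mulr1.

Lemma tlift_eE x : tlift_mul (inr 1) x = inr (tlift_ghost x).
Proof.
by have [[n ->]|[m ->]] := tliftP x;
  rewrite tliftE ?tlift_ghost_tilde mul1r.
Qed.

Lemma tlift_mul0 x : tlift_mul (inr 0) x = inr 0.
Proof. by have [[n ->]|[m ->]] := tliftP x; rewrite tliftE mul0r. Qed.

Lemma tlift_e_idem : tlift_mul (inr 1) (inr 1) = inr 1.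
Proof. by rewrite tlift_eE. Qed.

Lemma tlift_e_eq0 x : tlift_mul (inr 1) x = inr 0 -> x = inr 0.
Proof.
rewrite tlift_eE => -[]; case: x => [x /to_ghost_eq0 x0|m /= -> //].
by have := valP x; rewrite x0 eqxx.
Qed.

Lemma tlift_le_total x y :
  tlift_le (tlift_mul (inr 1) x) (tlift_mul (inr 1) y)
  || tlift_le (tlift_mul (inr 1) y) (tlift_mul (inr 1) x).
Proof. by rewrite !tlift_eE /tlift_le !bple_ghostE gle_total. Qed.

Lemma tlift_le_anti x y :
  tlift_le (tlift_mul (inr 1) x) (tlift_mul (inr 1) y) ->
  tlift_le (tlift_mul (inr 1) y) (tlift_mul (inr 1) x) ->
  tlift_mul (inr 1) x = tlift_mul (inr 1) y.
Proof.
rewrite !tlift_eE /tlift_le !bple_ghostE /= => xy yx.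
by rewrite (gle_anti xy yx).
Qed.

Lemma tlift_le_trans y x z :
  tlift_le (tlift_mul (inr 1) x) (tlift_mul (inr 1) y) ->
  tlift_le (tlift_mul (inr 1) y) (tlift_mul (inr 1) z) ->
  tlift_le (tlift_mul (inr 1) x) (tlift_mul (inr 1) z).
Proof. by rewrite !tlift_eE /tlift_le !bple_ghostE; apply: gle_trans. Qed.

Lemma tlift_le_mul x y z :
  tlift_le (tlift_mul (inr 1) x) (tlift_mul (inr 1) y) ->
  tlift_le (tlift_mul (tlift_mul (inr 1) x) (tlift_mul (inr 1) z))
           (tlift_mul (tlift_mul (inr 1) y) (tlift_mul (inr 1) z)).
Proof. by rewrite !tlift_eE /tlift_le !bple_ghostE; apply: gle_mul. Qed.

Lemma tlift_le0 x : tlift_le (inr 0) (tlift_mul (inr 1) x).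
Proof. by rewrite tlift_eE /tlift_le /bple /= add0r. Qed.

HB.instance Definition _ := isSupertropicalMonoid.Build tlift
  tlift_mulC tlift_mul0 tlift_e_idem tlift_e_eq0
  tlift_le_total tlift_le_anti tlift_le_trans tlift_le_mul tlift_le0.

Lemma tlift_ste x : (ste * x)%g = inr (tlift_ghost x) :> tlift.
Proof. exact: tlift_eE. Qed.

(* The ghost ideal of the tangible lift is [eU]. *)
Definition tlift_gh (m : ghost U) : ghost tlift := to_ghost (inr m : tlift).

Lemma val_tlift_gh m : val (tlift_gh m) = inr m.
Proof. by rewrite /= tlift_ste. Qed.

Lemma tlift_gh_ghost x : tlift_gh (tlift_ghost x) = to_ghost x.
Proof. by apply: val_inj; rewrite val_tlift_gh /= tlift_ste. Qed.

Lemma tlift_gh_nmod : nmod_morphism tlift_gh.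
Proof.
split; first by apply: val_inj; rewrite val_tlift_gh.
move=> a b; rewrite {2}/GRing.add /= /gadd !val_tlift_gh /=.
rewrite /stle /= /tlift_le /= bple_ghostE {1}/GRing.add /= /gadd.
by case: ifP.
Qed.

Lemma tlift_gh_monoid : monoid_morphism tlift_gh.
Proof.
split; first by apply: val_inj; rewrite val_tlift_gh /= tlift_ste
  tlift_ghost_tilde /= (msv1 (msvP phi)).
by move=> a b; apply: val_inj; rewrite val_gmul !val_tlift_gh.
Qed.

HB.instance Definition _ :=
  GRing.isNmodMorphism.Build (ghost U) (ghost tlift) tlift_gh tlift_gh_nmod.
HB.instance Definition _ :=
  GRing.isMonoidMorphism.Build (ghost U) (ghost tlift) tlift_gh tlift_gh_monoid.

Lemma tlift_gh_bij : bijective tlift_gh.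
Proof.
exists (fun x : ghost tlift => tlift_ghost (val x)) => [m|x].
  by rewrite val_tlift_gh.
by rewrite tlift_gh_ghost to_ghost_val.
Qed.

Definition tlift_fun (a : R) : tlift := tilde (to_img a).

Lemma to_ghost_tlift_fun a :
  to_ghost (tlift_fun a) = tlift_gh (to_ghost (phi a)).
Proof. by rewrite -tlift_gh_ghost tlift_ghost_tilde. Qed.

Lemma tlift_msvP : is_msupervaluation tlift_fun.
Proof.
have [p0 p1 pM [g0 g1 gM gD]] := msvP phi.
split=> [||a b|]; first exact: tilde0.
- by [].
- rewrite [RHS]tildeM; congr tilde; apply: val_inj; exact: pM.
split=> [||a b|a b]; rewrite !to_ghost_tlift_fun.
- by rewrite g0 raddf0.
- by rewrite g1 rmorph1.
- by rewrite gM rmorphM.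
- by rewrite /bple -!raddfD /= (eqP (gD a b)).
Qed.

Definition tilde_msv : msupervaluation R := MSupervaluation tlift_msvP.

End TangibleLift.

Section TangibleLiftCover.
Variables (R : comPzSemiRingType) (M : bipotentSemiRingType) (v : R -> M).
Variable phi : mcover v.

Definition tilde_iso : {rmorphism M -> ghost (msv_target (tilde_msv phi))} :=
  (@tlift_gh _ phi \o cov_iso phi : {rmorphism _ -> _}).

Lemma tilde_iso_bij : bijective tilde_iso.
Proof. exact: bij_comp (tlift_gh_bij phi) (cov_iso_bij phi). Qed.

Lemma tilde_covE a : to_ghost (tilde_msv phi a) = tilde_iso (v a).
Proof. by rewrite /= to_ghost_tlift_fun covE. Qed.

Definition tilde_cover : mcover v := MCover tilde_iso_bij tilde_covE.

End TangibleLiftCover.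

(** * The tangible lift outside an ideal *)

Record is_ideal (M : comPzSemiRingType) (a : set M) : Prop := IsIdeal {
  ideal0 : a 0;
  idealD : forall x y, a x -> a y -> a (x + y);
  idealM : forall x y, a x -> a (x * y)
}.

Section LiftOutside.
Variables (R : comPzSemiRingType) (M : bipotentSemiRingType) (v : R -> M).

(* Ideals of [M] contained in the ghost value set of [phi]. *)
Record ghost_value_ideal (phi : mcover v) := GhostValueIdeal {
  gvi_set :> set M;
  gvi_ideal : is_ideal gvi_set;
  gvi_sub : gvi_set `<=` ghost_values phi
}.

Variables (phi : mcover v) (a : ghost_value_ideal phi).

(* [s(a) `|` M] *)
Definition outside_ideal : set (tlift phi) :=
  [set y | is_ghost y \/
     exists n m, [/\ gvi_set a m, val n = val (cov_iso phi m) & y = tilde n]].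

Lemma outside_idealM x z : outside_ideal x -> outside_ideal (x * z)%g.
Proof.
case=> [gx|[n [m [am nm ->]]]]; first by left; rewrite stmulC is_ghostM.
have [[k ->]|[l ->]] := tliftP z; last first.
  by left; apply: is_ghostM; apply/eqP; rewrite tlift_ste.
right; have [g gK Kg] := cov_iso_bij phi.
exists (img_mul n k), (m * g (to_ghost (val k))); split.
- exact: idealM (gvi_ideal a) _ _ am.
- by rewrite rmorphM Kg val_gmul /= nm mulgA (stmulC _ ste) valgE.
- exact: tildeM.
Qed.

(* [E_a] *)
Definition outside_mfce : mfce (tlift phi) := collapse outside_idealM.

Definition tilde_outside : mcover v :=
  @quot_cover R M v (tilde_cover phi) outside_mfce.

End LiftOutside.

(** ** The ideal [v(q')], where [q' = v^-1(0) `|` Y(v)] *)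

Section Check.
Variables (R : comPzSemiRingType) (M : bipotentSemiRingType) (v : R -> M).
Hypothesis vP : is_mvaluation v.
Hypothesis v_surj : forall m, exists a, v a = m.

Definition qset : set R := v @^-1` [set 0].
Definition q'set : set R := qset `|` Yset v.

Lemma vq'_ideal : is_ideal (v @` q'set).
Proof.
split.
- by exists 0; [left; exact: mval0 | exact: mval0].
- by move=> x y ax ay; case: (bipotent x y) => ->.
- move=> _ y [p q'p <-]; have [c <-] := v_surj y.
  exists (p * c); last exact: mvalM.
  have [vpc|/eqP vpc] := eqVneq (v (p * c)) 0; first by left.
  case: q'p => [vp|[a [b [pE [a' [lta eqab _]]]]]].
    by case: vpc; rewrite (mvalM vP) vp mul0r.
  right; exists a, (b * c); split; first by rewrite pE mulrA.
  exists a'; split=> //; last by rewrite mulrA -pE.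
  by rewrite !mulrA (mvalM vP) eqab -(mvalM vP).
Qed.

Variable phi : mcover v.
Hypothesis phi_sv : is_supervaluation phi.

Lemma cov_ste a : (ste * phi a)%g = val (cov_iso phi (v a)).
Proof. by rewrite -covE. Qed.

Lemma Yset_ghost p : Yset v p -> is_ghost (phi p).
Proof.
case=> a [b [-> [a' [/andP[le_a ne_a] eqab _]]]].
rewrite (msvM (msvP phi)) (stmulC (phi a)).
have lt_a : stlt (ste * phi a')%g (ste * phi a)%g.
  rewrite /stlt !cov_ste -bple_ghostE /bple -rmorphD (eqP le_a) eqxx /=.
  by rewrite (inj_eq val_inj) (inj_eq (bij_inj (cov_iso_bij phi))).
have eg : (ste * (phi b * (ste * phi a')) = ste * (phi b * phi a))%g.
  rewrite steM eeE -steM -!(msvM (msvP phi)) !cov_ste.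
  by rewrite (mulrC b a') (mulrC b a) eqab.
have := phi_sv (phi b) (ste * phi a')%g (phi a).
rewrite {1}/stadd eeE lt_a => ->.
by rewrite /stadd eg /stlt eqxx andbF is_ghost_ste.
Qed.

Lemma vq'_sub : v @` q'set `<=` ghost_values phi.
Proof.
move=> _ [p q'p <-]; exists p; rewrite -cov_ste.
case: q'p => [vp|/Yset_ghost /ghost_e //].
  have p0 : phi p = stzero by apply: to_ghost_eq0; rewrite covE vp rmorph0.
  by rewrite p0 stmul_r0.
Qed.

Definition check_ideal : ghost_value_ideal phi :=
  GhostValueIdeal vq'_ideal vq'_sub.

(* The tangible lift of [phi] outside [v(q')]. *)
Definition check_cover : mcover v := tilde_outside check_ideal.

End Check.

(* Main.v *)
(* A supertropical monoid is a semiring iff all its NC-products are ghost.  In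
   the target of a surjective cover of [v], a tangible NC-product is the image
   of an element of [Y(v)], and conversely every element of [Y(v)] is sent to
   an NC-product.  So turning into ghosts the values of the tangible lift on
   [Y(v)] is the same as turning into ghosts its tangible NC-products, and it
   is the least one has to do to reach a semiring.  For the equality of
   intervals, a cover below a surjective supervaluation is equivalent to a
   quotient of the latter, and quotients of semirings are semirings. *)
Require Import Defs.
From mathcomp Require Import all_boot all_order all_algebra.
From mathcomp Require Import boolp classical_sets.

Set Implicit Arguments.
Unset Strict Implicit.
Unset Printing Implicit Defensive.

Import GRing.Theory.
Local Open Scope ring_scope.
Local Open Scope classical_set_scope.

(** * NC-products and distributivity *)

(** Distribute [z] over the sum of [y'] and [y]: the sum is [y], whereas [z * y'] and [z * y] have
    the same ghost, so their sum is a ghost. *)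
Lemma stsemiring_NC_ghost (V : stMonoidType) (x : V) :
  is_stsemiring V -> is_NC_product x -> is_ghost x.
Proof.
move=> sV [y [z [-> [y' [gy' lt_y' eq_y' _]]]]].
have ey' := ghost_e gy'.
have := sV z y' y; rewrite {1}/stadd ey' lt_y' (stmulC z y) => ->.
have e_eq : (ste * (z * y') = ste * (y * z))%g.
  by rewrite (stmulC z y') eq_y' mulgA mulgA ste_idem mulgA.
by rewrite /stadd e_eq /stlt eqxx andbF is_ghost_ste.
Qed.

(** Distributivity can fail only where multiplication by [x] merges two distinct ghost values. The
    product with the larger element is then zero or an NC-product, hence a ghost, which is what the
    sum requires. *)
Lemma NC_ghost_stsemiring (V : stMonoidType) :
  (forall x : V, is_NC_product x -> is_ghost x) -> is_stsemiring V.
Proof.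
move=> gNC x.
have stltE (a b : V) : stlt (ste * a)%g (ste * b)%g ->
    stlt (ste * b)%g (ste * a)%g = false.
  case/andP=> ab nab; apply/negP => /andP[ba _].
  by rewrite (stle_anti _ _ ab ba) eqxx in nab.
have step (y z : V) : stlt (ste * y)%g (ste * z)%g ->
    stadd (x * y)%g (x * z)%g = (x * z)%g /\
    stadd (x * z)%g (x * y)%g = (x * z)%g.
  move=> lt_yz; have /andP[/(@stle_mul _ _ _ x) le_yz _] := lt_yz.
  rewrite -!steM !(stmulC _ x) in le_yz.
  have [eq_yz|ne_yz] := eqVneq (ste * (x * y))%g (ste * (x * z))%g; last first.
    have lt_xyz : stlt (ste * (x * y))%g (ste * (x * z))%g.
      by rewrite /stlt le_yz ne_yz.
    by rewrite /stadd lt_xyz (stltE _ _ lt_xyz).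
  have /ghost_e gxz : is_ghost (x * z)%g.
    (* NC-products are nonzero by definition, so zero is treated apart. *)
    have [/ste_eq0 ->|/eqP xz0] := eqVneq (ste * (x * z))%g stzero.
      by rewrite /is_ghost stmul_r0.
    apply: gNC; exists z, x; split; first exact: stmulC.
    exists (ste * y)%g; split; rewrite ?is_ghost_ste -?mulgA ?(stmulC z) //.
    by rewrite (stmulC y).
  by rewrite /stadd eq_yz /stlt eqxx andbF.
move=> y z; rewrite {1}/stadd; case: ifP => lt_yz; first by case: (step _ _ lt_yz).
case: ifP => lt_zy; first by case: (step _ _ lt_zy).
have eq_yz : (ste * y = ste * z)%g.
  have := stle_total y z; move: lt_yz lt_zy; rewrite /stlt eq_sym.
  by case: eqVneq => //= _; rewrite !andbT => -> ->.
have e_eq : (ste * (x * y) = ste * (x * z))%g by rewrite !steM eq_yz.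
by rewrite /stadd e_eq /stlt eqxx andbF mulgA (stmulC x) -mulgA.
Qed.

(** * Quotients that are semirings *)

Lemma stquot_ghostP (V : stMonoidType) (E : mfce V) (x : V) :
  is_ghost (stpi E x) <-> E (ste * x)%g x.
Proof. by rewrite -stpi_eq -qmulE; split=> [/eqP|/eqP]. Qed.

(** Since [E] preserves ghost values, every NC-product of the quotient lifts to an NC-product of
    [V]. *)
Lemma quot_stsemiring (V : stMonoidType) (E : mfce V) :
  (forall x : V, is_NC_product x -> E (ste * x)%g x) ->
  is_stsemiring (stquot E).
Proof.
move=> ENC; apply: NC_ghost_stsemiring => _ [Y [Z [-> ]]].
have [y ->] := stpiP Y; have [z ->] := stpiP Z.
case=> _ [/ghostP[Y' ->]]; have [y' ->] := stpiP Y'.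
rewrite !qmulE => /andP[le_y' ne_y'] /stpi_eq/mfce_fiber eq_y' ne0.
apply/stquot_ghostP/ENC; exists y, z; split=> //; exists (ste * y')%g.
split; first exact: is_ghost_ste.
- apply/andP; split; last by apply: contraNneq ne_y' => ->.
  by move: le_y'; rewrite /stle /= qleE !eeE.
- by move: eq_y'; rewrite -!(mulgA ste) !eeE.
- by move=> eyz0; apply: ne0; rewrite eyz0.
Qed.

Lemma hat_stsemiring (V : stMonoidType) : is_stsemiring (stquot (NC_mfce V)).
Proof.
apply: quot_stsemiring => x NCx; apply/collapse_relP.
have [gx|tx] := boolP (is_ghost x); first by left; apply: ghost_e.
right; split; [left; exact: is_ghost_ste | right | exact: eeE].
by exists 1%g, x; rewrite mul1g.
Qed.

Lemma quot_of_stsemiring (V : stMonoidType) (E : mfce V) :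
  is_stsemiring V -> is_stsemiring (stquot E).
Proof.
move=> sV; apply: quot_stsemiring => x /(stsemiring_NC_ghost sV) /ghost_e ->.
exact: equiv_refl.
Qed.

(** [collapse] carries a proof of stability, so equating two collapses takes proof irrelevance. *)
Lemma eq_collapse (V : stMonoidType) (A B : set V)
    (Amul : forall x z, A x -> A (x * z)%g)
    (Bmul : forall x z, B x -> B (x * z)%g) :
  A = B -> collapse Amul = collapse Bmul.
Proof.
by move=> eqAB; case: B / eqAB Bmul => Bmul; rewrite (Prop_irrelevance Amul Bmul).
Qed.

(** * The dominance order *)

Section MsvOrder.
Variable R : comPzSemiRingType.
Implicit Types phi psi rho : msupervaluation R.

Lemma msv_le_refl phi : msv_le phi phi. Proof. by split. Qed.

Lemma msv_le_trans psi phi rho :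
  msv_le phi psi -> msv_le psi rho -> msv_le phi rho.
Proof.
case=> f1 o1 g1 [f2 o2 g2].
by split=> [a b /f2/f1|a b /o2/o1|a /g2/g1].
Qed.

Lemma quot_msv_le psi (E : mfce (msv_target psi)) : msv_le (quot_msv E) psi.
Proof.
split=> [a b /= ->//|a b|a /ghost_e ga] /=.
  by rewrite !qmulE /stle /= qleE !eeE.
by apply/stquot_ghostP; rewrite ga; apply: equiv_refl.
Qed.

Lemma quot_msv_surj psi (E : mfce (msv_target psi)) :
  is_surjective_msv psi -> is_surjective_msv (quot_msv E).
Proof.
move=> surj X; have [x ->] := stpiP X.
by have [[a ->]|[a ->]] := surj x; [left|right]; exists a; rewrite //= qmulE.
Qed.

Lemma msv_ste_mul psi a b :
  (ste * psi a * psi b = ste * psi (a * b)%R)%g.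
Proof. by rewrite (msvM (msvP psi)) mulgA. Qed.

End MsvOrder.

(** * Covers of a fixed m-valuation *)

Section Covers.
Variables (R : comPzSemiRingType) (M : bipotentSemiRingType) (v : R -> M).
Implicit Types psi rho : mcover v.

Lemma cov_ste_eq psi a b : (ste * psi a = ste * psi b)%g <-> v a = v b.
Proof.
rewrite !cov_ste; split=> [/val_inj|-> //].
exact: (bij_inj (cov_iso_bij psi)).
Qed.

Lemma cov_stle psi a b : stle (ste * psi a)%g (ste * psi b)%g = bple (v a) (v b).
Proof.
rewrite !cov_ste -bple_ghostE /bple -rmorphD.
by rewrite (inj_eq (bij_inj (cov_iso_bij psi))).
Qed.

Lemma cov_stlt psi a b : stlt (ste * psi a)%g (ste * psi b)%g = bplt (v a) (v b).
Proof.
rewrite /stlt cov_stle /bplt; congr (_ && ~~ _).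
by apply/eqP/eqP => /(cov_ste_eq psi).
Qed.

Lemma cov_eq0 psi a : psi a = stzero <-> v a = 0.
Proof.
split=> [a0|va0]; last by apply: to_ghost_eq0; rewrite covE va0 rmorph0.
apply: (bij_inj (cov_iso_bij psi)).
by rewrite -covE a0 to_ghost0 rmorph0.
Qed.

(** The order condition is automatic: both sides compare [v a] with [v b]. *)
Lemma msv_le_cov psi rho :
  (forall a b, rho a = rho b -> psi a = psi b) ->
  (forall a, is_ghost (rho a) -> is_ghost (psi a)) -> msv_le psi rho.
Proof. by move=> f g; split=> [|a b|] //; rewrite !cov_stle. Qed.

Lemma Yset_NC_product psi p : Yset v p -> is_NC_product (psi p).
Proof.
case=> a [b [-> [a' [lt_a eq_ab ne0]]]].
exists (psi a), (psi b); split; first exact: msvM (msvP psi) _ _.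
exists (ste * psi a')%g; rewrite is_ghost_ste cov_stlt lt_a !msv_ste_mul.
split=> //; first exact/cov_ste_eq.
by move=> /ste_eq0/cov_eq0.
Qed.

(** A tangible product has tangible factors, which surjectivity makes values of [psi]; of [y'] only
    the ghost value matters. *)
Lemma NC_tangible_Yset psi x : is_surjective_msv psi ->
  NC_tangible x -> exists2 p, Yset v p & x = psi p.
Proof.
move=> surj [tx [y [z [xE [_ [/ghostP[y' ->] lt_y' eq_y' ne0]]]]]].
rewrite xE in tx *.
have [[a yE]|[a yE]] := surj y; last first.
  by rewrite yE stmulC is_ghostM ?is_ghost_ste in tx.
have [[b zE]|[b zE]] := surj z; last by rewrite zE is_ghostM ?is_ghost_ste in tx.
have [a' y'E] : exists a', (ste * y' = ste * psi a')%g.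
  by have [[a' ->]|[a' ->]] := surj y'; exists a'; rewrite ?eeE.
exists (a * b); last by rewrite yE zE (msvM (msvP psi)).
exists a, b; split=> //; exists a'.
move: lt_y' eq_y' ne0; rewrite y'E yE zE cov_stlt !msv_ste_mul.
move=> lt_a' /cov_ste_eq -> ne0; split=> //.
by move=> /cov_eq0 ab0; apply: ne0; rewrite ab0 stmul_r0.
Qed.

(* The kernel of the transmission [rho a |-> psi a], [e (rho a) |-> e (psi a)]. *)
Lemma msv_le_quot psi rho : is_surjective_msv rho -> msv_le psi rho ->
  exists E : mfce (msv_target rho), msv_equiv psi (quot_cover (psi := rho) E).
Proof.
move=> surj le_psi.
have e_rho a b : (ste * rho a = ste * rho b)%g -> (ste * psi a = ste * psi b)%g.
  by move=> /cov_ste_eq ab; apply/cov_ste_eq.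
have psi_e a b : rho a = (ste * rho b)%g -> psi a = (ste * psi b)%g.
  move=> ab; have /(msv_le_ghost le_psi)/ghost_e <- : is_ghost (rho a).
    by rewrite ab is_ghost_ste.
  by apply: e_rho; rewrite ab eeE.
(* An element may be both a value [rho a] and a ghost [ste * rho b]; by [psi_e] the two
   prescriptions then agree. *)
have /choice[f fP] : forall x, exists y : msv_target psi,
    (forall a, x = rho a -> y = psi a) /\
    (forall a, x = (ste * rho a)%g -> y = (ste * psi a)%g).
  move=> x; have [[a ->]|[a ->]] := surj x.
    exists (psi a); split=> b; [exact: msv_le_fun le_psi _ _ | exact: psi_e].
  exists (ste * psi a)%g; split=> b; last exact: e_rho.
  by move=> /esym/psi_e.
have f_rho a : f (rho a) = psi a by apply: (fP _).1.
have f_e a : f (ste * rho a)%g = (ste * psi a)%g by apply: (fP _).2.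
have fM x y : f (x * y)%g = (f x * f y)%g.
  have [[a ->]|[a ->]] := surj x; have [[b ->]|[b ->]] := surj y;
    rewrite ?f_rho ?f_e.
  - by rewrite -!(msvM (msvP _)) f_rho.
  - by rewrite stmulC msv_ste_mul f_e -msv_ste_mul stmulC.
  - by rewrite !msv_ste_mul f_e.
  - by rewrite -!steM -!(msvM (msvP _)) f_e.
(* [f] separates ghosts because [psi] and [rho] cover the same [v]. *)
have f_fiber x y : f x = f y -> (ste * x = ste * y)%g.
  have e_f a b : (ste * psi a = ste * psi b)%g -> (ste * rho a = ste * rho b)%g.
    by move=> /cov_ste_eq ab; apply/cov_ste_eq.
  have [[a ->]|[a ->]] := surj x; have [[b ->]|[b ->]] := surj y;
    rewrite ?f_rho ?f_e ?eeE => /(congr1 (fun z => ste * z)%g); rewrite ?eeE;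
    exact: e_f.
pose k : rel (msv_target rho) := fun x y => f x == f y.
have k_refl : reflexive k by move=> x; apply: eqxx.
have k_sym : symmetric k by move=> x y; apply: eq_sym.
have k_trans : transitive k by move=> y x z /eqP xy /eqP yz; rewrite /k xy yz.
pose K := EquivRel k k_refl k_sym k_trans.
have K_mul x y z : K x y -> K (x * z)%g (y * z)%g.
  by move=> /eqP xy; apply/eqP; rewrite !fM xy.
have K_fiber x y : K x y -> (ste * x = ste * y)%g by move=> /eqP/f_fiber.
exists (MFCE K_mul K_fiber); split; apply: msv_le_cov => [a b|a].
- by move=> /stpi_eq/eqP; rewrite !f_rho.
- by move=> /stquot_ghostP/eqP; rewrite f_e f_rho => /eqP.
- by move=> ab; apply/stpi_eq/eqP; rewrite !f_rho.
- by move=> /ghost_e ga; apply/stquot_ghostP/eqP; rewrite f_e f_rho.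
Qed.

Lemma class_ofP psi rho : class_of psi = class_of rho -> msv_equiv psi rho.
Proof.
move=> eqC; have : class_of psi psi by split; apply: msv_le_refl.
by rewrite eqC => -[].
Qed.

Lemma eq_class_of psi rho : msv_equiv psi rho -> class_of psi = class_of rho.
Proof.
case=> pr rp; apply/funext => s; apply/propext.
split=> -[h1 h2]; split; [exact: msv_le_trans rp h1|exact: msv_le_trans h2 pr
  |exact: msv_le_trans pr h1|exact: msv_le_trans h2 rp].
Qed.

End Covers.

(** * Surjectivity of the tangible lift *)

Section TangibleLift.
Variables (R : comPzSemiRingType) (M : bipotentSemiRingType) (v : R -> M).
Variable phi : mcover v.

Lemma tilde_cover_surj : (forall m, exists a, v a = m) ->
  is_surjective_msv (tilde_cover phi).
Proof.
move=> v_surj x; have [[n ->]|[m ->]] := tliftP x.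
  left; case: n => y y_img; have /asboolP[a ya] := y_img; exists a.
  by congr tilde; apply: val_inj.
right; have [g gK Kg] := cov_iso_bij phi; have [a va] := v_surj (g m).
by exists a; rewrite tlift_ste tlift_ghost_tilde /= covE va Kg.
Qed.

End TangibleLift.

(** * The lift outside the ideal given by [Yset v] *)

Section Check.
Variables (R : comPzSemiRingType) (M : bipotentSemiRingType) (v : R -> M).
Hypothesis vP : is_mvaluation v.
Hypothesis v_surj : forall m, exists a, v a = m.
Variables (phi : mcover v) (phi_sv : is_supervaluation phi).

Let tphi : mcover v := tilde_cover phi.
Let cphi : mcover v := check_cover vP v_surj phi_sv.
Let check_set : set (tlift phi) :=
  @outside_ideal _ _ _ phi (check_ideal vP v_surj phi_sv).

(** As [phi] is ghost on [Yset v], the ghost value [v p] is [phi p] itself, and its tangible copy is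
    [tphi p]. Elements with [v p = 0] only contribute zero, a ghost. *)
Lemma check_setP x :
  check_set x <-> is_ghost x \/ exists2 p, Yset v p & x = tphi p.
Proof.
split=> [[gx|[n [_ [[p q'p <-] nE ->]]]]|]; first by left.
  rewrite -cov_ste in nE; case: q'p => [vp0|Yp].
    left; rewrite tilde0; first by apply/eqP; rewrite tlift_ste.
    by rewrite nE (cov_eq0 phi p).2 ?stmul_r0.
  right; exists p => //; congr tilde; apply: val_inj.
  by rewrite nE (ghost_e (Yset_ghost phi_sv Yp)).
case=> [gx|[p Yp ->]]; first by left.
right; exists (to_img phi p), (v p); split=> //; first by exists p => //; right.
by rewrite -cov_ste (ghost_e (Yset_ghost phi_sv Yp)).
Qed.

Lemma check_set_NC_ideal : check_set = NC_ideal (V := tlift phi).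
Proof.
apply/predeqP => x; rewrite check_setP; split=> [[gx|[p Yp ->]]|]; first by left.
  have [gp|tp] := boolP (is_ghost (tphi p)); first by left.
  right; exists 1%g, (tphi p); rewrite mul1g; split=> //; split=> //.
  exact: (Yset_NC_product tphi Yp).
case=> [gx|[z [s [Ss ->]]]]; first by left.
(* [check_set] absorbs the factor [z]. *)
apply/check_setP; rewrite stmulC; apply: outside_idealM; apply/check_setP.
have [p Yp sE] := NC_tangible_Yset (psi := tphi) (tilde_cover_surj v_surj) Ss.
by right; exists p.
Qed.

Lemma check_cover_hat : cphi = hat_cover tphi.
Proof.
by rewrite /cphi /check_cover /tilde_outside /outside_mfce
  (eq_collapse _ (@NC_idealM _) check_set_NC_ideal).
Qed.

Lemma check_supervaluation : is_supervaluation cphi.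
Proof. by rewrite check_cover_hat; apply: hat_stsemiring. Qed.

Lemma check_cover_surj : is_surjective_msv cphi.
Proof. exact/quot_msv_surj/tilde_cover_surj. Qed.

Lemma check_le_tilde : msv_le cphi tphi.
Proof. exact: quot_msv_le. Qed.

Lemma check_set_ghost (psi : mcover v) a :
  msv_le psi tphi -> is_supervaluation psi -> check_set (tphi a) -> is_ghost (psi a).
Proof.
move=> le_psi sv_psi /check_setP[|[p Yp] /(msv_le_fun le_psi) ->].
  exact: (msv_le_ghost le_psi).
exact: Yset_ghost Yp.
Qed.

Lemma supervaluation_le_check (psi : mcover v) : msv_le psi tphi ->
  is_supervaluation psi -> msv_le psi cphi.
Proof.
move=> le_psi sv_psi.
apply: msv_le_cov => [a b|a].
  (* In the collapsed case [psi a] and [psi b] are ghosts over the same value of [v]. *)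
  move=> /stpi_eq/collapse_relP[/(msv_le_fun le_psi)//|[Ca Cb]].
  move=> /(cov_ste_eq tphi)/(cov_ste_eq psi).
  by rewrite !ghost_e ?(check_set_ghost le_psi sv_psi).
move=> /stquot_ghostP/collapse_relP[/eqP/(msv_le_ghost le_psi)//|[_ Ca _]].
exact: check_set_ghost Ca.
Qed.

(** A tangible NC-product would be a value of [psi] on [Yset v], where [cphi], being a
    supervaluation, is ghost. Surjectivity rules out NC-products unrelated to [R]. *)
Lemma le_check_supervaluation (psi : mcover v) : is_surjective_msv psi ->
  msv_le psi cphi -> is_supervaluation psi.
Proof.
move=> surj le_psi; apply: NC_ghost_stsemiring => x NCx.
apply: contraT => tx.
have [p Yp xE] := NC_tangible_Yset surj (conj tx NCx).
by rewrite xE (msv_le_ghost le_psi) ?(Yset_ghost check_supervaluation) in tx.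
Qed.

Lemma check_interval (C : covering_class v) :
  cov_interval phi tphi C /\ Cov C <-> cov_interval phi cphi C.
Proof.
split=> [[[psi [le1 le2 CE]] [psi' [sv CE']]]|[psi [le1 le2 CE]]].
  (* Equivalence does not control the part of a target that is not reached from [R], so the
     representative is switched to [psi'], whose target is a semiring. *)
  have [le12 le21] := class_ofP (etrans (esym CE) CE').
  exists psi'; split=> //; first exact: msv_le_trans le12.
  by apply: supervaluation_le_check => //; apply: msv_le_trans le2.
split.
  by exists psi; split=> //; apply: msv_le_trans le2 check_le_tilde.
(* [psi] may fail to be surjective; a quotient of [cphi] represents its class with a semiring as
   target. *)
have [E eqE] := msv_le_quot check_cover_surj le2.
exists (quot_cover (psi := cphi) E); split.
  exact/quot_of_stsemiring/check_supervaluation.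
by rewrite CE; apply: eq_class_of.
Qed.

End Check.

Theorem theorem2p13 (R : comPzSemiRingType) (M : bipotentSemiRingType)
    (v : R -> M) (vP : is_mvaluation v) (v_surj : forall m, exists a, v a = m)
    (phi : mcover v) (phi_surj : is_surjective_msv phi)
    (phi_sv : is_supervaluation phi) :
  let tphi : mcover v := tilde_cover phi in
  let cphi : mcover v := check_cover vP v_surj phi_sv in
  (* (i) *)
  (is_supervaluation cphi /\ cphi = hat_cover tphi) /\
  (* (ii) *)
  (forall psi : mcover v, msv_le phi psi -> msv_le psi tphi ->
     (is_supervaluation psi -> msv_le psi cphi) /\
     (is_surjective_msv psi -> (is_supervaluation psi <-> msv_le psi cphi))) /\
  (forall C : covering_class v,
     cov_interval phi tphi C /\ Cov C <-> cov_interval phi cphi C).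
Proof.
split; first by split; [exact: check_supervaluation | exact: check_cover_hat].
split=> [psi _ le_psi|C]; last exact: check_interval.
split; first exact: supervaluation_le_check.
move=> surj; split; first exact: supervaluation_le_check.
exact: le_check_supervaluation.
Qed.
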